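(* Using the complex reflection group $G_{26}$, one constructs a curve of degree $18$ in $\mathbb{P}^2(\mathbb{C})$ with $36$ singular points of type $E_6$. (The author does not know whether such a bound was already reached.)
   Context: $G_{26}\subset \mathrm{GL}_3(\mathbb{C})$ denotes the primitive complex reflection group of rank $3$ with number 26 in the Shephard–Todd classification; it has order $1296$ and degrees $6,12,18$. Curves are constructed from polynomial invariants of the group. A plane curve singularity of type $E_6$ is one equivalent to $y^3-x^4$. *)

(* Defs.v *)
From mathcomp Require Import all_boot all_order all_algebra.
From mathcomp Require Import complex.
(* mpoly's notations clash with those of the analysis library. *)
From mathcomp Require Import -(notations) mpoly.
From mathcomp Require Import all_classical all_reals all_analysis.

Set Implicit Arguments.
Unset Strict Implicit.
Unset Printing Implicit Defensive.

Import Order.TTheory GRing.Theory Num.Theory.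
Import numFieldNormedType.Exports.

Local Open Scope classical_set_scope.
Local Open Scope ring_scope.
Local Open Scope complex_scope.

Section Group.
Variable R : realType.
Local Notation C := R[i].

Definition is_matrix_group n (H : set 'M[C]_n) : Prop :=
  [/\ H `<=` [set g | g \in unitmx],
      H 1%:M,
      forall g h, H g -> H h -> H (g *m h)
    & forall g, H g -> H (invmx g)].

Definition matrix_group_generated n (S : set 'M[C]_n) : set 'M[C]_n :=
  smallest (@is_matrix_group n) S.

(* A primitive cube root of unity. *)
Definition omega : C := (- (1 / 2)) +i* (Num.sqrt 3 / 2).

(* Reflections of orders 2, 3, 3 with roots (0,1,-1), (0,0,1), (1,1,1). They
   satisfy the relations of the Coxeter-like diagram 2 =(4)= 3 -(3)- 3 of
   G_26: s t s t = t s t s, t u t = u t u, s u = u s. *)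
Definition G26_s : 'M[C]_3 := tperm_mx 1 2.
Definition G26_t : 'M[C]_3 := 1%:M + (omega - 1) *: delta_mx 2 2.
Definition G26_u : 'M[C]_3 := 1%:M + ((omega - 1) / 3) *: const_mx 1.

Definition G26 : set 'M[C]_3 :=
  matrix_group_generated [set g | [\/ g = G26_s, g = G26_t | g = G26_u]].

End Group.

Section Curves.
Variable R : realType.
Local Notation C := R[i].
Local Notation C2 := (C^o * C^o)%type.
Local Notation form := (mpoly 3 C).

Definition eval3 (f : form) (v : 'cV[C]_3) : C :=
  meval (fun i => v i 0) f.

Definition invariant_under (G : set 'M[C]_3) (f : form) : Prop :=
  forall g v, G g -> eval3 f (g *m v) = eval3 f v.

Definition squarefree_form (f : form) : Prop :=
  forall g h : form, f = g ^+ 2 * h -> (msize g <= 1)%N.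

(* Equation of a (reduced) curve of degree d in P^2(C). Reducedness makes d the
   degree of the zero locus itself. *)
Definition plane_curve_equation (d : nat) (f : form) : Prop :=
  [/\ f != 0, f \is ishomog1 d mdeg & squarefree_form f].

(* The points of P^2(C) are the lines of C^3. *)
Definition P2 : set {vspace 'cV[C]_3} := [set p | \dim p = 1%N].

(* Isomorphism of the germs at the origin of the plane curves g = 0 and h = 0:
   psi is a holomorphic change of coordinates and u a unit, i.e. the ideals
   (h) and (g \o psi) of holomorphic germs coincide. Differentiability is over
   the scalar field C. *)
Definition germ_equivalent (h g : C2 -> C^o) : Prop :=
  exists (psi : C2 -> C2) (u : C2 -> C^o),
    [/\ psi (0, 0) = (0, 0),
        (\forall z \near ((0, 0) : C2), differentiable psi z),
        bijective ('d psi ((0, 0) : C2)),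
        (\forall z \near ((0, 0) : C2), differentiable u z) /\ u (0, 0) != 0
      & \forall z \near ((0, 0) : C2), h z = u z * g (psi z)].

Definition E6_normal_form (z : C2) : C^o := z.2 ^+ 3 - z.1 ^+ 4.

(* The equation of the curve in the affine chart
   (x, y) |-> [M_0 + x M_1 + y M_2] of P^2(C), where M_i is the i-th column
   of M; the chart is centred at [M_0]. *)
Definition affine_equation (f : form) (M : 'M[C]_3) (z : C2) : C^o :=
  eval3 f (M *m \col_i [:: 1; z.1; z.2]`_i).

(* Independent of the affine chart centred at p. *)
Definition E6_point (f : form) (p : {vspace 'cV[C]_3}) : Prop :=
  exists M : 'M[C]_3,
    [/\ M \in unitmx, col 0 M \in p
      & germ_equivalent (affine_equation f M) E6_normal_form].

End Curves.

(* Main.v *)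
(* Invariants of degrees 6, 12 and 18 of G_26 identify P^2 / G_26 with the
   weighted projective plane P(6,12,18) = P(1,2,3). There the mirrors of order 2
   and 3 become C6^3 - 3 C6 C12 + 2 C18 = 0 and C12^3 = C18^2, and these curves
   cross transversally at the image of (1 : 1 : 0). A point with stabilizer
   Z/2 x Z/3 lies above it, where the quotient map is (x, y) |-> (x^2, y^3); so
   a curve which is tangent there to the mirror of order 3 pulls back to
   x^4 = y^3 along an orbit of 1296 / 36 = 36 points. The curve
   16 C18 + 12 C6 C12 - C6^3 = 0 is such a curve.

   A point equivalent to E_6 is singular. Outside the fixed 36 lines of C^3 the
   gradient does not vanish: the form is a symmetric polynomial in the cubes
   X, Y, Z of the coordinates, and one separates the cases Z = 0, X = Y, and
   X, Y, Z distinct, where elementary symmetric functions are coordinates.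
   The form is square-free because the zero locus of a factor g of multiplicity
   2 would be contained in these 36 lines; the restriction of g to a line that
   avoids them has no zero, hence is constant. *)
Require Import Defs.
From mathcomp Require Import all_boot all_order all_algebra.
From mathcomp Require Import perm ring.
From mathcomp Require Import complex.
From mathcomp Require Import -(notations) mpoly.
From mathcomp Require Import all_classical all_reals all_analysis.

Set Implicit Arguments.
Unset Strict Implicit.
Unset Printing Implicit Defensive.

Import Order.TTheory GRing.Theory Num.Theory.
Import numFieldNormedType.Exports.

Local Open Scope classical_set_scope.
Local Open Scope ring_scope.
Local Open Scope complex_scope.

(** * The form as a symmetric sextic in the cubes of the coordinates *)

Section Sextic.
Variable K : comNzRingType.
Implicit Types X Y Z : K.

(* Invariants of G_26 as polynomials in the cubes of the coordinates. *)
Definition inv6 X Y Z := X ^+ 2 + Y ^+ 2 + Z ^+ 2 - 10 * (X * Y + Y * Z + Z * X).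
Definition inv12 X Y Z := (X + Y + Z) * ((X + Y + Z) ^+ 3 + 216 * (X * Y * Z)).
Definition inv18 X Y Z :=
  (X + Y + Z) ^+ 6 - 540 * (X * Y * Z) * (X + Y + Z) ^+ 3
  - 5832 * (X * Y * Z) ^+ 2.

Definition sextic X Y Z :=
  16 * inv18 X Y Z + 12 * (inv6 X Y Z * inv12 X Y Z) - inv6 X Y Z ^+ 3.

(** The partial derivative of [sextic] in its first argument. By symmetry, cyclic rotation of the
    arguments gives the other two. *)
Definition sextic1 X Y Z :=
  16 * (6 * (X + Y + Z) ^+ 5
        - 540 * (Y * Z * (X + Y + Z) ^+ 3 + 3 * (X * Y * Z) * (X + Y + Z) ^+ 2)
        - 11664 * X * (Y * Z) ^+ 2)
  + 12 * ((2 * X - 10 * (Y + Z)) * inv12 X Y Z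
          + inv6 X Y Z * (4 * (X + Y + Z) ^+ 3 + 216 * (X * Y * Z)
                          + 216 * (X + Y + Z) * (Y * Z)))
  - 3 * inv6 X Y Z ^+ 2 * (2 * X - 10 * (Y + Z)).

Lemma sextic_rot X Y Z : sextic Y Z X = sextic X Y Z.
Proof. by rewrite /sextic /inv18 /inv12 /inv6; ring. Qed.

Lemma sextic_swap X Y Z : sextic X Z Y = sextic X Y Z.
Proof. by rewrite /sextic /inv18 /inv12 /inv6; ring. Qed.

(** The fourfold factor [X - Y] is the source of the term [x^4] of the singularity at
    [(1 : 1 : 0)]. *)
Lemma sextic_Z0 X Y :
  sextic X Y 0 = 27 * (X - Y) ^+ 4 * (X ^+ 2 + 6 * X * Y + Y ^+ 2).
Proof. by rewrite /sextic /inv18 /inv12 /inv6; ring. Qed.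

Lemma sextic1_Z0 X Y :
  sextic1 X Y 0 =
  27 * (X - Y) ^+ 3 * (4 * (X ^+ 2 + 6 * X * Y + Y ^+ 2) + (X - Y) * (2 * X + 6 * Y)).
Proof. by rewrite /sextic1 /inv12 /inv6; ring. Qed.

Lemma sextic_XX X Z :
  sextic X X Z = 27 * inv6 X X Z * Z * (Z + 8 * X) ^+ 3.
Proof. by rewrite /sextic /inv18 /inv12 /inv6; ring. Qed.

Lemma sextic1_XX X Z :
  sextic1 Z X X =
  27 * ((2 * Z - 20 * X) * Z * (Z + 8 * X) ^+ 3
        + inv6 X X Z * ((Z + 8 * X) ^+ 3 + 3 * Z * (Z + 8 * X) ^+ 2)).
Proof. by rewrite /sextic1 /inv12 /inv6; ring. Qed.

Lemma sextic_euler X Y Z :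
  X * sextic1 X Y Z + Y * sextic1 Y Z X + Z * sextic1 Z X Y = 6 * sextic X Y Z.
Proof. by rewrite /sextic1 /sextic /inv18 /inv12 /inv6; ring. Qed.

(** In elementary symmetric coordinates the difference of the partials in [X] and [Y] is [Y - X]
    times the derivative in the second coordinate plus [Z] times the derivative in the third. *)
Lemma sextic1B X Y Z :
  sextic1 X Y Z - sextic1 Y Z X =
  36 * ((Y - X) * ((inv6 X Y Z ^+ 2 - 4 * inv12 X Y Z)
    + Z * (24 * (3 * inv6 X Y Z * (X + Y + Z) - 10 * (X + Y + Z) ^+ 3
                 - 216 * (X * Y * Z))))).
Proof. by rewrite /sextic1 /inv12 /inv6; ring. Qed.

End Sextic.

(** * Critical zeros of the sextic *)

Section SingularCubes.
Variable K : numFieldType.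
Implicit Types X Y Z : K.

(* The quotient map by permutations, whose coordinates are the elementary
   symmetric functions, is a local isomorphism where [X], [Y], [Z] are distinct;
   so all three partial derivatives in these coordinates vanish. *)
Lemma sextic_crit_ndistinct X Y Z :
  sextic1 X Y Z = 0 -> sextic1 Y Z X = 0 -> sextic1 Z X Y = 0 ->
  [|| X == Y, Y == Z | Z == X].
Proof.
move=> h1 h2 h3; apply/negPn/negP; rewrite !negb_or.
rewrite -(subr_eq0 X) -(subr_eq0 Y) -(subr_eq0 Z).
case/and3P=> nXY nYZ nZX.
set s := X + Y + Z; set e := X * Y * Z.
set a := inv6 X Y Z; set b := inv12 X Y Z.
(* Up to the factor 36, [phi2] and [phi3] are the derivatives in the second and third elementary
   symmetric functions. *)
pose phi2 := a ^+ 2 - 4 * b.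
pose phi3 := 24 * (3 * a * s - 10 * s ^+ 3 - 216 * e).
have inv6_rot : inv6 Y Z X = a by rewrite /a /inv6; ring.
have inv12_rot : inv12 Y Z X = b by rewrite /b /inv12; ring.
have s_rot : Y + Z + X = s by rewrite /s; ring.
have e_rot : Y * Z * X = e by rewrite /e; ring.
have d12 : 36 * ((Y - X) * (phi2 + Z * phi3)) = sextic1 X Y Z - sextic1 Y Z X.
  by rewrite sextic1B.
have d23 : 36 * ((Z - Y) * (phi2 + X * phi3)) = sextic1 Y Z X - sextic1 Z X Y.
  by rewrite sextic1B inv6_rot inv12_rot s_rot e_rot.
have {}d12 : phi2 + Z * phi3 = 0.
  apply/eqP; move/eqP: d12; rewrite h1 h2 subrr !mulf_eq0 pnatr_eq0 -opprB oppr_eq0.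
  by rewrite (negPf nXY).
have {}d23 : phi2 + X * phi3 = 0.
  apply/eqP; move/eqP: d23; rewrite h2 h3 subrr !mulf_eq0 pnatr_eq0 -opprB oppr_eq0.
  by rewrite (negPf nYZ).
have p3 : phi3 = 0.
  apply: (mulfI nZX); rewrite mulr0.
  have -> : (Z - X) * phi3 = (phi2 + Z * phi3) - (phi2 + X * phi3) by ring.
  by rewrite d12 d23 subrr.
have p2 : 4 * b = a ^+ 2.
  by apply/esym/subr0_eq; move: d12; rewrite p3 mulr0 addr0.
have sa : a * s = 10 / 3 * s ^+ 3 + 72 * e.
  move/eqP: p3; rewrite /phi3 mulf_eq0 pnatr_eq0 /= => /eqP p3.
  have -> : a * s = (3 * a * s - 10 * s ^+ 3 - 216 * e) / 3
                    + (10 / 3 * s ^+ 3 + 72 * e) by field.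
  by rewrite p3 mul0r add0r.
(* Eliminating [a] from [(a s)^2 = 4 b s^2] leaves a relation between [s] and [e] that happens to be
   a perfect square. *)
have e3 : 27 * e = s ^+ 3.
  have : (72 * e - 8 / 3 * s ^+ 3) ^+ 2 = 0.
    transitivity ((10 / 3 * s ^+ 3 + 72 * e) ^+ 2 - 4 * b * s ^+ 2).
      by rewrite /b /inv12 -/s -/e; field.
    by rewrite -sa p2; ring.
  move/eqP; rewrite sqrf_eq0 subr_eq0 => /eqP h.
  have -> : 27 * e = 3 / 8 * (72 * e) by field.
  by rewrite h; field.
have sym_sum : s * (X * Y + Y * Z + Z * X) = - (5 / 12) * s ^+ 3.
  have -> : s * (X * Y + Y * Z + Z * X) = (s ^+ 3 - a * s) / 12.
    by rewrite /a /inv6 /s; field.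
  rewrite sa; have -> : 72 * e = 72 / 27 * (27 * e) by field.
  by rewrite e3; field.
have [s0 | s0] := eqVneq s 0.
  have e0 : e = 0.
    have := e3; rewrite s0 expr0n /= => /eqP; rewrite mulf_eq0 pnatr_eq0 /=.
    by move/eqP.
  have a0 : a = 0.
    apply/eqP; rewrite -sqrf_eq0 -p2 /b /inv12 -/s s0; apply/eqP; ring.
  have q0 : X * Y + Y * Z + Z * X = 0.
    have -> : X * Y + Y * Z + Z * X = (s ^+ 2 - a) / 12.
      by rewrite /s /a /inv6; field.
    by rewrite s0 a0 expr0n /= subr0 mul0r.
  have root0 W : (W - X) * (W - Y) * (W - Z) = 0 -> W = 0.
    have -> : (W - X) * (W - Y) * (W - Z) =
        W ^+ 3 - s * W ^+ 2 + (X * Y + Y * Z + Z * X) * W - e.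
      by rewrite /s /e; ring.
    rewrite s0 e0 q0 !mul0r !subr0 addr0 => /eqP.
    by rewrite expf_eq0 /= => /eqP.
  have x0 : X = 0 by apply: root0; ring.
  have y0 : Y = 0 by apply: root0; ring.
  by move: nXY; rewrite x0 y0 subrr eqxx.
have q1 : X * Y + Y * Z + Z * X = - (5 / 12) * s ^+ 2.
  by apply: (mulfI s0); rewrite sym_sum; ring.
(* The cubic with roots [X], [Y], [Z] is now determined by [s] and has the double root [- s / 6];
   only two values remain for three roots, so two of them coincide. *)
have dbl W : (W - X) * (W - Y) * (W - Z) = 0 -> (W == - s / 6) || (W == 4 * s / 3).
  have -> : (W - X) * (W - Y) * (W - Z) =
      W ^+ 3 - s * W ^+ 2 + (X * Y + Y * Z + Z * X) * W - (27 * e) / 27.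
    by rewrite /s /e; field.
  rewrite q1 e3.
  have -> : W ^+ 3 - s * W ^+ 2 + - (5 / 12) * s ^+ 2 * W - s ^+ 3 / 27
     = (W - - s / 6) ^+ 2 * (W - 4 * s / 3) by field.
  by move/eqP; rewrite mulf_eq0 sqrf_eq0 !subr_eq0.
move: nXY nYZ nZX; rewrite !subr_eq0.
have dX : (X - X) * (X - Y) * (X - Z) = 0 by rewrite subrr !mul0r.
have dY : (Y - X) * (Y - Y) * (Y - Z) = 0 by rewrite subrr mulr0 mul0r.
have dZ : (Z - X) * (Z - Y) * (Z - Z) = 0 by rewrite subrr mulr0.
by case/orP: (dbl X dX) => /eqP->; case/orP: (dbl Y dY) => /eqP->;
  case/orP: (dbl Z dZ) => /eqP->; rewrite !eqxx.
Qed.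

(** At a critical zero on the factor [inv6 X X Z], either another factor of [sextic_XX] vanishes or
    so does the derivative [2 Z - 20 X] of [inv6]. The latter gives [Z = 10 X], where [inv6] equals
    [- 108 X^2]. *)
Lemma sextic_crit_XX X Z : X != 0 -> sextic X X Z = 0 ->
  Z * sextic1 Z X X = 0 -> (Z == 0) || (Z == - 8 * X).
Proof.
move=> X0 + hZ; rewrite sextic_XX => /eqP.
rewrite mulf_eq0 expf_eq0 2!mulf_eq0 pnatr_eq0 /= (addr_eq0 Z) -(mulNr 8) -orbA.
case/orP => [/eqP a0 | //]; move/eqP: hZ; rewrite mulf_eq0 => /orP[-> // | hZ].
move: hZ; rewrite sextic1_XX a0 mul0r addr0 3!mulf_eq0 expf_eq0 pnatr_eq0 /=.
rewrite (addr_eq0 Z) -(mulNr 8) -orbA => /orP[/eqP zx | //].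
have zx' : Z = 10 * X.
  have -> : Z = (2 * Z - 20 * X) / 2 + 10 * X by field.
  by rewrite zx mul0r add0r.
move: a0; rewrite zx' /inv6.
have -> : X ^+ 2 + X ^+ 2 + (10 * X) ^+ 2 - 10 * (X * X + X * (10 * X) + 10 * X * X) =
   - (108 * X ^+ 2) by ring.
move/eqP; rewrite oppr_eq0 mulf_eq0 pnatr_eq0 sqrf_eq0 /= => /eqP x0.
by rewrite x0 eqxx in X0.
Qed.

(** The quadratic factor of [sextic_Z0] has simple roots, so a critical zero must lie on [X = Y]. *)
Lemma sextic_crit_Z0 X Y : sextic X Y 0 = 0 -> X * sextic1 X Y 0 = 0 ->
  X = Y.
Proof.
rewrite sextic_Z0 => /eqP; rewrite 2!mulf_eq0 expf_eq0 pnatr_eq0 /= subr_eq0.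
case/orP => [/eqP // | /eqP q0]; rewrite sextic1_Z0 q0 mulr0 add0r.
move/eqP; rewrite 3!mulf_eq0 expf_eq0 mulf_eq0 pnatr_eq0 /= subr_eq0.
have Y0 : (X == 0) -> X = Y.
  move/eqP=> x0; move: q0; rewrite x0 => /eqP.
  rewrite expr0n /= mulr0 mul0r !add0r sqrf_eq0 => /eqP -> //.
case/orP => [/Y0 // | /or3P[/eqP // | /eqP // | /eqP h]].
have xy : X = - 3 * Y.
  have -> : X = (2 * X + 6 * Y) / 2 - 3 * Y by field.
  by rewrite h; ring.
move: q0; rewrite xy.
have -> : (- 3 * Y) ^+ 2 + 6 * (- 3 * Y) * Y + Y ^+ 2 = - (8 * Y ^+ 2) by ring.
move/eqP; rewrite oppr_eq0 mulf_eq0 pnatr_eq0 sqrf_eq0 /= => /eqP ->.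
by rewrite mulr0.
Qed.

(** Up to a cyclic shift, cubing the coordinates sends the 36 points to [(1 : 1 : 0)] and
    [(1 : 1 : -8)]. *)
Definition cusp_cubes X Y Z := [&& X == Y, X != 0 & (Z == 0) || (Z == - 8 * X)].

(** The factors [X], [Y], [Z] in front of the partials reflect the substitution of cubes: its
    derivative [3 x^2] vanishes on the coordinate lines, where the partials of the sextic itself are
    not controlled. *)
Lemma sextic_crit X Y Z : [|| X != 0, Y != 0 | Z != 0] ->
  sextic X Y Z = 0 -> X * sextic1 X Y Z = 0 -> Y * sextic1 Y Z X = 0 ->
  Z * sextic1 Z X Y = 0 ->
  [|| cusp_cubes X Y Z, cusp_cubes Y Z X | cusp_cubes Z X Y].
Proof.
have zero X' Y' Z' : [|| X' != 0, Y' != 0 | Z' != 0] -> Z' = 0 ->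
    sextic X' Y' Z' = 0 -> X' * sextic1 X' Y' Z' = 0 -> cusp_cubes X' Y' Z'.
  move=> + z0; rewrite z0 eqxx orbF => + h1 h2; rewrite /cusp_cubes eqxx andbT.
  by rewrite (sextic_crit_Z0 h1 h2) eqxx orbb.
have eqn X' Y' Z' : X' != 0 -> X' = Y' -> sextic X' Y' Z' = 0 ->
    Z' * sextic1 Z' X' Y' = 0 -> cusp_cubes X' Y' Z'.
  move=> x0 <- h1 h2; rewrite /cusp_cubes eqxx x0; exact: sextic_crit_XX.
move=> nz h hX hY hZ.
have [X0 | X0] := eqVneq X 0.
  apply/or3P/Or32/zero => //; last by rewrite sextic_rot.
  by case/or3P: nz => ->; rewrite ?orbT.
have [Y0 | Y0] := eqVneq Y 0.
  apply/or3P/Or33/zero => //; last by rewrite -sextic_rot.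
  by case/or3P: nz => ->; rewrite ?orbT.
have [Z0 | Z0] := eqVneq Z 0; first by apply/or3P/Or31/zero.
have c1 : sextic1 X Y Z = 0 by apply: (mulfI X0); rewrite mulr0.
have c2 : sextic1 Y Z X = 0 by apply: (mulfI Y0); rewrite mulr0.
have c3 : sextic1 Z X Y = 0 by apply: (mulfI Z0); rewrite mulr0.
case/or3P: (sextic_crit_ndistinct c1 c2 c3) => /eqP e.
- by apply/or3P/Or31/eqn.
- by apply/or3P/Or32/eqn => //; rewrite sextic_rot.
- by apply/or3P/Or33/eqn => //; rewrite -sextic_rot.
Qed.

End SingularCubes.

(** * Nonzero polynomials have nonzero values *)

Section NonVanishing.
Variable K : numFieldType.

Lemma poly_nonroot (p : {poly K}) : p != 0 -> exists t, p.[t] != 0.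
Proof.
move=> p0; pose s := [seq i%:R : K | i <- iota 0 (size p)].
have us : uniq s.
  by rewrite map_inj_uniq ?iota_uniq // => i j /eqP; rewrite eqr_nat => /eqP.
have : ~~ all (root p) s.
  by apply/negP => /(max_poly_roots p0)/(_ us); rewrite size_map size_iota ltnn.
by case/allPn => t _ ?; exists t.
Qed.

(** Base-[N] digits are peeled off by reduction modulo [N]. This makes the exponents of the
    Kronecker substitution distinct. *)
Lemma digits_inj n N (m1 m2 : 'I_n -> nat) :
  (forall i, m1 i < N)%N -> (forall i, m2 i < N)%N ->
  (\sum_i m1 i * N ^ i = \sum_i m2 i * N ^ i)%N -> m1 =1 m2.
Proof.
elim: n m1 m2 => [|n IH] m1 m2 h1 h2; first by move=> _ [].
rewrite !big_ord_recl /= !expn0 !muln1.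
have N0 : (0 < N)%N by apply: leq_trans (h1 ord0).
have shift (m : 'I_n.+1 -> nat) : (\sum_(i < n) m (lift ord0 i) * N ^ bump 0 i =
    (\sum_(i < n) m (lift ord0 i) * N ^ i) * N)%N.
  by rewrite big_distrl /=; apply: eq_bigr => i _; rewrite expnS mulnCA mulnC.
rewrite !shift => e.
have e0 : m1 ord0 = m2 ord0.
  by have := congr1 (modn^~ N) e; rewrite ![(m1 _ + _)%N]addnC ![(m2 _ + _)%N]addnC
     !modnMDl !modn_small.
move/eqP: e; rewrite e0 eqn_add2l eqn_pmul2r // => /eqP e i.
have := IH _ _ (fun j => h1 (lift ord0 j)) (fun j => h2 (lift ord0 j)) e.
by case: (unliftP ord0 i) => [j -> | ->].
Qed.

(* Kronecker substitution [x_i := t ^ (N ^ i)]. *)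
Lemma mpoly_nonvanishing n (p : mpoly n K) :
  p != 0 -> exists v, meval v p != 0.
Proof.
move=> p0; set N := msize p.
pose k (m : multinom n) := (\sum_i m i * N ^ i)%N.
pose q : {poly K} := \sum_(m <- msupp p) mcoeff m p *: 'X^(k m).
have ltN (m : multinom n) i : m \in msupp p -> (m i < N)%N.
  move=> /msize_mdeg_lt; apply: leq_ltn_trans.
  by rewrite mdegE (bigD1 i) //= leq_addr.
(* Distinct monomials go to distinct powers, so the coefficient of [q] at [k (mlead p)] is the
   leading coefficient of [p]. *)
have q0 : q != 0.
  have m0 := mlead_supp p0.
  apply/eqP => /(congr1 (fun r : {poly K} => r`_(k (mlead p)))).
  rewrite /q coef_sum coef0 (bigD1_seq (mlead p)) ?msupp_uniq //=.
  rewrite coefZ coefXn eqxx mulr1.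
  rewrite big1_seq ?addr0.
    by move/eqP; rewrite mleadc_eq0 (negPf p0).
  move=> m /andP[nm mp]; rewrite coefZ coefXn; case: eqP => [e | _]; last exact: mulr0.
  case/eqP: nm; apply/mnmP => i.
  apply: (@digits_inj _ N (fun i => m i) (fun i => mlead p i)) => [j|j|].
  - exact: ltN.
  - exact: ltN.
  - by rewrite -/(k m) -/(k (mlead p)) e.
have [t qt] := poly_nonroot q0.
exists (fun i => t ^+ (N ^ i)); apply: contra qt => /eqP ev; apply/eqP.
rewrite -[RHS]ev mevalE /q horner_sum; apply: eq_bigr => m _.
rewrite hornerZ hornerXn; congr (_ * _); rewrite /k -prodrXr.
by apply: eq_bigr => i _; rewrite mulnC exprM.
Qed.

End NonVanishing.

(** * The form of degree 18, its gradient and its singular points *)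

Section Form.
Variable K : comNzRingType.

Definition cubic_sextic (x y z : K) := sextic (x ^+ 3) (y ^+ 3) (z ^+ 3).

End Form.

(** Covers evaluation at a point, restriction to a line, and evaluation of the restriction. *)
Lemma rmorph_cubic_sextic (K L : comNzRingType) (h : {rmorphism K -> L}) x y z :
  h (cubic_sextic x y z) = cubic_sextic (h x) (h y) (h z).
Proof.
have hn n a : h (n%:R * a) = n%:R * h a by rewrite rmorphM rmorph_nat.
have hnA n a b : h (n%:R * a * b) = n%:R * h a * h b by rewrite rmorphM hn.
rewrite /cubic_sextic /sextic /inv18 /inv12 /inv6.
by rewrite !(hn, hnA, rmorphB, rmorphD, rmorphXn, rmorphM).
Qed.

Section Deriv.
Variable K : comNzRingType.
Implicit Types P Q R : {poly K}.

Lemma deriv_sextic P Q R :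
  (sextic P Q R)^`() =
  P^`() * sextic1 P Q R + Q^`() * sextic1 Q R P + R^`() * sextic1 R P Q.
Proof.
have dn n (p : {poly K}) : (n%:R * p)^`() = n%:R * p^`().
  by rewrite !mulr_natl derivMn.
have dX n (p : {poly K}) : (p ^+ n.+1)^`() = n.+1%:R * (p^`() * p ^+ n).
  by rewrite deriv_exp mulr_natl.
rewrite /sextic /inv18 /inv12 /inv6.
rewrite !(derivB, derivD, dn, dX, derivM).
rewrite /sextic1 /inv12 /inv6; move: P^`() Q^`() R^`() => P' Q' R'; ring.
Qed.

(** The partial derivative of [cubic_sextic] in its first argument; rotation gives the others. *)
Definition partial1 (x y z : K) := 3 * x ^+ 2 * sextic1 (x ^+ 3) (y ^+ 3) (z ^+ 3).

Lemma deriv_cubic_sextic P Q R : (cubic_sextic P Q R)^`().[0] =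
  P^`().[0] * partial1 P.[0] Q.[0] R.[0] + Q^`().[0] * partial1 Q.[0] R.[0] P.[0]
  + R^`().[0] * partial1 R.[0] P.[0] Q.[0].
Proof.
rewrite /cubic_sextic deriv_sextic !deriv_exp /= /partial1.
have hn n (p : {poly K}) : (n%:R * p).[0] = n%:R * p.[0].
  by rewrite hornerM -polyC_natr hornerC.
have hnA n (p q : {poly K}) : (n%:R * p * q).[0] = n%:R * p.[0] * q.[0].
  by rewrite hornerM hn.
have h1 p q r : (sextic1 p q r).[0] = sextic1 p.[0] q.[0] r.[0] :> K.
  rewrite /sextic1 /inv12 /inv6.
  by rewrite !(hn, hnA, hornerD, hornerN, horner_exp, hornerM).
have hMn n (p : {poly K}) : (p *+ n).[0] = n%:R * p.[0].
  by rewrite hornerMn mulr_natl.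
rewrite !(h1, hornerD, hornerM, hMn, horner_exp).
by move: (sextic1 _ _ _) (sextic1 _ _ _) (sextic1 _ _ _) => s1 s2 s3; ring.
Qed.

End Deriv.

Section CurveForm.
Variable K : comNzRingType.

Definition var (i : 'I_3) : mpoly 3 K := mpolyX K (mnm1 i).

Definition curve_form : mpoly 3 K := cubic_sextic (var 0) (var 1) (var 2).

Lemma meval_curve_form v : meval v curve_form = cubic_sextic (v 0) (v 1) (v 2).
Proof. by rewrite rmorph_cubic_sextic /= !mevalXU. Qed.

Lemma curve_form_homog : curve_form \is ishomog1 18 mdeg.
Proof.
have X3 i : var i ^+ 3 \is ishomog1 3 mdeg.
  by apply: (@dhomogMn _ _ _ 1); rewrite dhomogX; apply/eqP/mdeg1.
have nM n d (p : mpoly 3 K) : p \is ishomog1 d mdeg -> n%:R * p \is ishomog1 d mdeg.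
  by rewrite mulr_natl; apply: rpredMn.
rewrite /curve_form /cubic_sextic.
move: (var 0 ^+ 3) (var 1 ^+ 3) (var 2 ^+ 3) (X3 0) (X3 1) (X3 2) => X Y Z hX hY hZ.
have hs : X + Y + Z \is ishomog1 3 mdeg by rewrite !rpredD.
have ht : X * Y * Z \is ishomog1 9 mdeg.
  exact: (dhomogM (dhomogM hX hY) hZ).
have h6 : inv6 X Y Z \is ishomog1 6 mdeg.
  rewrite /inv6 rpredB ?nM // !rpredD //;
    rewrite ?(dhomogM hX hY) ?(dhomogM hY hZ) ?(dhomogM hZ hX) //.
  - exact: (dhomogMn 2 hX).
  - exact: (dhomogMn 2 hY).
  - exact: (dhomogMn 2 hZ).
have h12 : inv12 X Y Z \is ishomog1 12 mdeg.
  apply: (@dhomogM _ _ _ 3 _ 9) => //; rewrite rpredD ?nM //.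
  exact: (dhomogMn 3 hs).
have h18 : inv18 X Y Z \is ishomog1 18 mdeg.
  rewrite /inv18 !rpredB //.
  - exact: (dhomogMn 6 hs).
  - exact: (dhomogM (nM 540 _ _ ht) (dhomogMn 3 hs)).
  - exact: (nM 5832 _ _ (dhomogMn 2 ht)).
rewrite /sextic rpredB ?rpredD ?nM //.
- exact: (dhomogM h6 h12).
- exact: (dhomogMn 3 h6).
Qed.

End CurveForm.

Section Singular.
Variable K : numFieldType.

Definition singular (x y z : K) :=
  [/\ cubic_sextic x y z = 0, partial1 x y z = 0, partial1 y z x = 0 & partial1 z x y = 0].

Lemma singular_cubes x y z : [|| x != 0, y != 0 | z != 0] -> singular x y z ->
  [|| cusp_cubes (x ^+ 3) (y ^+ 3) (z ^+ 3), cusp_cubes (y ^+ 3) (z ^+ 3) (x ^+ 3)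
    | cusp_cubes (z ^+ 3) (x ^+ 3) (y ^+ 3)].
Proof.
have cub (t : K) : (t ^+ 3 != 0) = (t != 0) by rewrite expf_eq0.
have g1 (a b c : K) : partial1 a b c = 0 -> a ^+ 3 * sextic1 (a ^+ 3) (b ^+ 3) (c ^+ 3) = 0.
  rewrite /partial1 => /eqP; rewrite -mulrA mulf_eq0 pnatr_eq0 /= => /eqP h.
  by rewrite exprS -mulrA h mulr0.
move=> nz [h0 h1 h2 h3]; apply: sextic_crit; rewrite ?cub //; exact: g1.
Qed.

(** Restriction to the line [v + t d] reduces the gradient to derivatives in one variable, both for
    square factors and for affine equations. *)
Lemma horner_deriv_line (v d : 'I_3 -> K) (p : {poly K}) :
  p = cubic_sextic ((v 0)%:P + d 0 *: 'X) ((v 1)%:P + d 1 *: 'X)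
                   ((v 2)%:P + d 2 *: 'X) ->
  p.[0] = cubic_sextic (v 0) (v 1) (v 2) /\
  p^`().[0] = d 0 * partial1 (v 0) (v 1) (v 2) + d 1 * partial1 (v 1) (v 2) (v 0)
     + d 2 * partial1 (v 2) (v 0) (v 1).
Proof.
have l0 a b : (a%:P + b *: 'X).[0] = a :> K.
  by rewrite hornerD hornerC hornerZ hornerX mulr0 addr0.
have l1 a b : (a%:P + b *: 'X)^`().[0] = b :> K.
  by rewrite derivD derivC derivZ derivX add0r hornerZ hornerC mulr1.
move=> ->; split; last by rewrite deriv_cubic_sextic !l0 !l1.
transitivity (horner_eval 0 (cubic_sextic ((v 0)%:P + d 0 *: 'X)
  ((v 1)%:P + d 1 *: 'X) ((v 2)%:P + d 2 *: 'X))) => //.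
by rewrite rmorph_cubic_sextic; congr cubic_sextic; exact: l0.
Qed.

End Singular.

(** * Square-freeness *)

Section SquareFree.
Variable K : numClosedFieldType.
Implicit Types (g h : mpoly 3 K) (v : 'I_3 -> K).

Lemma horner_mmap n (h : 'I_n -> {poly K}) (g : mpoly n K) t :
  (mmap polyC h g).[t] = meval (fun j => (h j).[t]) g.
Proof.
rewrite mevalE /mmap horner_sum; apply: eq_bigr => m _.
rewrite hornerM hornerC /mmap1 horner_prod; congr (_ * _).
by apply: eq_bigr => i _; rewrite horner_exp.
Qed.

(** On every line through a zero of [g], the factor [g ^+ 2] vanishes to second order; the
    coordinate directions give the three partials. *)
Lemma singular_root g h v : curve_form K = g ^+ 2 * h -> meval v g = 0 ->
  singular (v 0) (v 1) (v 2).
Proof.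
move=> fE gv.
have key (d : 'I_3 -> K) : cubic_sextic (v 0) (v 1) (v 2) = 0 /\
    d 0 * partial1 (v 0) (v 1) (v 2) + d 1 * partial1 (v 1) (v 2) (v 0)
     + d 2 * partial1 (v 2) (v 0) (v 1) = 0.
  pose l i := (v i)%:P + d i *: 'X : {poly K}.
  have l0 i : (l i).[0] = v i by rewrite hornerD hornerC hornerZ hornerX mulr0 addr0.
  pose p := mmap polyC l (curve_form K).
  have [|<- <-] := @horner_deriv_line K v d p.
    have := rmorph_cubic_sextic (mmap polyC l) (var K 0) (var K 1) (var K 2).
    by rewrite /= !mmapX !mmap1U.
  have g0 : (mmap polyC l g).[0] = 0.
    by rewrite horner_mmap -[RHS]gv; apply: meval_eq.
  rewrite /p fE rmorphM rmorphXn /= expr2 !derivM !hornerE g0.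
  by rewrite !(mul0r, mulr0, addr0).
have [F0 _] := key (fun=> 0).
have [_ ] := key (fun i => (i == 0)%:R).
have [_ ] := key (fun i => (i == 1)%:R).
have [_ ] := key (fun i => (i == 2)%:R).
rewrite /= !(mul1r, mul0r, addr0, add0r) => ? ? ?; by split.
Qed.

(** At a singular point, two nonzero coordinates have cubes in ratio [1], [-8] or [-1/8].
    Nonvanishing of this product thus excludes singularity whatever the third coordinate is. *)
Definition off_cusps (a b : K) :=
  a * b * (a ^+ 3 - b ^+ 3) * (a ^+ 3 + 8 * b ^+ 3) * (b ^+ 3 + 8 * a ^+ 3).

Lemma off_cuspsP x y z : off_cusps y z != 0 -> ~ singular x y z.
Proof.
rewrite /off_cusps !mulf_eq0 !negb_or => /andP[/andP[/andP[/andP[y0 z0]]]].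
rewrite subr_eq0 !addr_eq0 -!mulNr => n1 n2 n3 /singular_cubes.
rewrite y0 orbT => /(_ isT); rewrite /cusp_cubes.
rewrite !(expf_eq0 _ 3) /= (negPf z0) (negPf y0) (negPf n1) /=.
case/orP => [/and3P[/eqP -> _] | /andP[_]]; first by rewrite (negPf n3).
by rewrite (negPf n2).
Qed.

Lemma singular_rot (x y z : K) : singular x y z -> singular y z x.
Proof. by case=> h0 h1 h2 h3; split=> //; rewrite /cubic_sextic sextic_rot. Qed.

Definition upd v i t := fun j => if j == i then t else v j.

(** The line in direction [i] avoids the singular points, so [g] restricted to it is a polynomial
    without roots over an algebraically closed field. *)
Lemma meval_upd g h v i t : curve_form K = g ^+ 2 * h ->
  off_cusps (v (i + 1)) (v (i + 2)) != 0 -> meval (upd v i t) g = meval (upd v i 0) g.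
Proof.
move=> fE B.
pose l j : {poly K} := if j == i then 'X else (v j)%:P.
have ev s : (mmap polyC l g).[s] = meval (upd v i s) g.
  rewrite horner_mmap; apply: meval_eq => j; rewrite /l /upd.
  by case: ifP; rewrite ?hornerX ?hornerC.
have : size (mmap polyC l g) == 1%N.
  apply/negPn/negP => /closed_rootP[s]; rewrite rootE ev => /eqP.
  move/(singular_root fE); set w := upd v i s => sw.
  have {sw} : singular (w i) (w (i + 1)) (w (i + 2)).
    case: i {B l ev} @w sw => [[|[|[|//]]] hi] w.
    - by congr singular; congr w; apply/val_inj.
    - move=> /singular_rot; by congr singular; congr w; apply/val_inj.
    - move=> /singular_rot/singular_rot; by congr singular; congr w; apply/val_inj.
  apply: off_cuspsP; rewrite /w /upd.
  by case: i {l ev w} B => [[|[|[|//]]] hi].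
by move=> /size_poly1P[c _ e]; rewrite -!ev e !hornerC.
Qed.

Lemma curve_form_squarefree g h : curve_form K = g ^+ 2 * h -> (msize g <= 1)%N.
Proof.
move=> fE.
have zero (p : mpoly 3 K) : (forall v, meval v p = 0) -> p = 0.
  move=> p0; apply/eqP/negPn/negP => /mpoly_nonvanishing[v].
  by rewrite p0 eqxx.
(* Independence of coordinate [i] extends from the set where [B] is nonzero to all points: [D * B]
   vanishes everywhere, and polynomials form an integral domain. *)
have meval_upd0 i v : meval v g = meval (upd v i 0) g.
  pose a := var K (i + 1); pose b := var K (i + 2).
  pose B := a * b * (a ^+ 3 - b ^+ 3) * (a ^+ 3 + 8 * b ^+ 3) * (b ^+ 3 + 8 * a ^+ 3).
  have evB w : meval w B = off_cusps (w (i + 1)) (w (i + 2)).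
    have X3 c : meval w (c ^+ 3) = meval w c ^+ 3 by rewrite rmorphXn.
    have M8 c : meval w (8 * c) = 8 * meval w c by rewrite rmorphM rmorph_nat.
    by rewrite /B /off_cusps !(M8, X3, mevalXU, mevalB, mevalD, mevalM).
  pose lq := [tuple of mktuple (fun j => if j == i then 0 else var K j)].
  pose D := g - comp_mpoly lq g.
  have evD w : meval w D = meval w g - meval (upd w i 0) g.
    rewrite /D mevalB comp_mpoly_meval; congr (_ - _); apply: meval_eq => j.
    by rewrite tnth_mktuple /upd; case: ifP; rewrite ?meval0 ?mevalXU.
  have B0 : B != 0.
    (* With coordinates 1 and 2 no factor of [off_cusps] vanishes. *)
    apply/eqP => /(congr1 (meval (fun j => if j == i + 1 then 1 else 2))).
    rewrite evB meval0 eqxx.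
    have -> : (i + 2 == i + 1) = false by case: i {a b B evB lq D evD} => [[|[|[|]]]].
    rewrite /off_cusps => /eqP; rewrite !mulf_eq0.
    have -> : 1 ^+ 3 - 2 ^+ 3 = - 7%:R :> K by ring.
    have -> : 1 ^+ 3 + 8 * 2 ^+ 3 = 65%:R :> K by ring.
    have -> : 2 ^+ 3 + 8 * 1 ^+ 3 = 16%:R :> K by ring.
    by rewrite oppr_eq0 !pnatr_eq0 oner_eq0.
  have : D * B = 0.
    apply: zero => w; rewrite mevalM evD evB.
    have [-> | nB] := eqVneq (off_cusps (w (i + 1)) (w (i + 2))) 0.
      by rewrite mulr0.
    rewrite -(meval_upd (w i) fE nB) (meval_eq (v2 := w)) ?subrr ?mul0r // => j.
    by rewrite /upd; case: eqP => // ->.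
  move/eqP; rewrite mulf_eq0 (negPf B0) orbF => /eqP D0.
  by apply/eqP; rewrite -subr_eq0 -evD D0 meval0.
have cst v : meval v g = meval (fun=> 0) g.
  rewrite (meval_upd0 0 v) (meval_upd0 1 (upd _ _ _)) (meval_upd0 2 (upd _ _ _)).
  by apply: meval_eq => -[[|[|[|]]]].
suff -> : g = mpolyC 3 (meval (fun=> 0) g) by rewrite msizeC leq_b1.
by apply/eqP; rewrite -subr_eq0; apply/eqP/zero => v; rewrite mevalB mevalC cst subrr.
Qed.

End SquareFree.

(** * Points with an [E_6] germ are singular *)

Section Germs.
Variable C : numFieldType.
Local Notation C2 := (C^o * C^o)%type.

Lemma differentiable_fst (z : C2) : differentiable (fst : C2 -> C^o) z.
Proof. by apply: linear_differentiable => x; exact: cvg_fst. Qed.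

Lemma differentiable_snd (z : C2) : differentiable (snd : C2 -> C^o) z.
Proof. by apply: linear_differentiable => x; exact: cvg_snd. Qed.

Lemma diff_fst (z : C2) : 'd (fst : C2 -> C^o) z = fst :> (C2 -> C^o).
Proof. by apply: diff_lin => x; exact: cvg_fst. Qed.

Lemma diff_snd (z : C2) : 'd (snd : C2 -> C^o) z = snd :> (C2 -> C^o).
Proof. by apply: diff_lin => x; exact: cvg_snd. Qed.

Lemma diffM_zero (f g : C2 -> C^o) z : differentiable f z -> differentiable g z ->
  f z = 0 -> 'd (f * g) z = g z \*: 'd f z :> (C2 -> C^o).
Proof.
move=> df dg f0; transitivity (f z \*: 'd g z + g z \*: 'd f z : C2 -> C^o).
  exact: (@diffM _ _ f g z df dg).
by rewrite f0; apply/funext => e; rewrite /= -[LHS]/(0 *: _ + _) scale0r add0r.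
Qed.

Lemma continuous_horner_num (p : {poly C}) : continuous (horner p : C^o -> C^o).
Proof.
elim/poly_ind: p => [|p c ih] x.
  have -> : horner (0 : {poly C}) = cst 0 by apply/funext => t; rewrite horner0.
  exact: cst_continuous.
have -> : horner (p * 'X + c%:P) = ((horner p : C^o -> C^o) * id + cst c)%R.
  by apply/funext => t; rewrite hornerMXaddC.
apply: (@continuousD _ _ C^o); last exact: cst_continuous.
by apply: continuousM; [exact: ih | exact: cvg_id].
Qed.

(** The difference quotient at 0 is a polynomial [q], whose limit is [q.[0]] by continuity. *)
Lemma derive_line (h : C2 -> C^o) (e : C2) (p : {poly C}) :
  (forall t : C, h (t *: e) = p.[t]) -> 'D_e h 0 = p^`().[0].
Proof.
move=> hp.
have [q pE] : exists q, p = q * 'X + (p.[0])%:P.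
  have : root (p - (p.[0])%:P) 0 by rewrite rootE !hornerE subrr.
  by case/factor_theorem => q; rewrite subr0 => qE; exists q; rewrite -qE subrK.
have hp0 : h 0 = p.[0] by rewrite -(hp 0) scale0r.
have -> : p^`().[0] = q.[0].
  rewrite pE derivD derivM derivX derivC addr0 mulr1.
  by rewrite hornerD hornerM hornerX mulr0 add0r.
rewrite /derive; apply: cvg_lim => //.
apply: cvg_trans (cvg_within_filter _ (@continuous_horner_num q 0)).
apply: near_eq_cvg; near=> t.
have t0 : t != 0 by near: t; exact: nbhs_dnbhs_neq.
have pt : p.[t] = q.[t] * t + p.[0] by rewrite {1}pE hornerMXaddC.
rewrite /= addr0 hp hp0 {1}pt addrK.
by rewrite -[RHS]/(t^-1 * (q.[t] * t)) mulrC mulfK.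

Unshelve. all: end_near. Qed.

(** By the product and chain rules, vanishing of [g] to second order passes to [u] times [g \o psi],
    and directional derivatives depend only on the germ. *)
Lemma derive_germ0 (h g u : C2 -> C^o) (psi : C2 -> C2) e :
  differentiable psi 0 -> differentiable u 0 -> differentiable g (psi 0) ->
  'd g (psi 0) = (fun=> 0) :> (C2 -> C^o) -> g (psi 0) = 0 ->
  (\forall z \near (0 : C2), h z = u z * g (psi z)) -> 'D_e h 0 = 0.
Proof.
move=> dpsi du dg g1 g0 hE.
rewrite (@near_eq_derive _ _ _ h ((g \o psi) * u)); last first.
  by near=> z; rewrite (near hE z) // mulrC.
have dgp : differentiable (g \o psi) 0 by exact: differentiable_comp.
rewrite deriveE; last exact: differentiableM.
rewrite diffM_zero // diff_comp // g1.
exact: scaler0.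
Unshelve. all: end_near. Qed.

Definition E6_polynomial (w : C2) : C^o := w.2 ^+ 3 - w.1 ^+ 4.

Lemma differentiable_E6 (z : C2) : differentiable E6_polynomial z.
Proof.
have d1 := differentiable_fst z; have d2 := differentiable_snd z.
apply: (@differentiableB _ _ _ ((snd : C2 -> C^o) ^+ 3) ((fst : C2 -> C^o) ^+ 4)).
  exact: differentiableX.
exact: differentiableX.
Qed.

Lemma diff_E6 : 'd E6_polynomial 0 = (fun=> 0) :> (C2 -> C^o).
Proof.
have d1 := differentiable_fst (0 : C2); have d2 := differentiable_snd (0 : C2).
pose f2 : C2 -> C^o := snd; pose f1 : C2 -> C^o := fst.
(* Each power is split into two factors that both vanish at the origin, so that [diffM_zero] yields
   zero. *)
transitivity ('d (f2 * (f2 ^+ 2)) 0 \- 'd (f1 * (f1 ^+ 3)) 0 : C2 -> C^o).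
  have dd := @diffB _ _ _ (f2 * (f2 ^+ 2)) (f1 * (f1 ^+ 3)) 0.
  apply: dd; apply: differentiableM => //; exact: differentiableX.
rewrite (@diffM_zero f2 (f2 ^+ 2)) //; last exact: differentiableX.
rewrite (@diffM_zero f1 (f1 ^+ 3)) //; last exact: differentiableX.
apply/funext => e.
have z2 : (f2 ^+ 2) 0 = 0 :> C by rewrite /f2 -[LHS]/(0 * 0) mulr0.
have z1 : (f1 ^+ 3) 0 = 0 :> C by rewrite /f1 -[LHS]/(0 * (0 * 0)) mul0r.
rewrite z2 z1 -[LHS]/(0 *: _ - 0 *: _) !scale0r subrr //.
Qed.

End Germs.

Section E6Singular.
Variable R : realType.
Local Notation C := R[i].
Local Notation C2 := (C^o * C^o)%type.

Lemma partial1_euler (x y z : C) :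
  x * partial1 x y z + y * partial1 y z x + z * partial1 z x y = 18 * cubic_sextic x y z.
Proof.
transitivity (3 * (6 * cubic_sextic x y z)); last by rewrite mulrA -natrM.
by rewrite /cubic_sextic -sextic_euler /partial1; ring.
Qed.

Lemma eval3_curve_form (v : 'cV[C]_3) :
  eval3 (curve_form C) v = cubic_sextic (v 0 0) (v 1 0) (v 2 0).
Proof. exact: meval_curve_form. Qed.

(** The vanishing chart derivatives make the gradient orthogonal to columns 1 and 2 of [M], and
    Euler's relation makes it orthogonal to column 0. Since [M] is invertible, the gradient is
    zero. *)
Lemma E6_singular (M : 'M[C]_3) : M \in unitmx ->
  germ_equivalent (affine_equation (curve_form C) M) (@E6_normal_form R) ->
  singular (M 0 0) (M 1 0) (M 2 0).
Proof.
move=> uM [psi [u [psi0 dpsi _ [du _] hE]]].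
set h := affine_equation _ _ in hE.
pose v i := M i 0.
have nf0 : E6_normal_form (psi 0) = 0.
  by rewrite -[psi 0]/(psi (0, 0)) psi0 /E6_normal_form /= !expr0n subrr.
have D0 e : 'D_e h 0 = 0.
  apply: (@derive_germ0 C h (@E6_normal_form R) u psi e _ _ _ _ nf0 hE).
  - exact: (nbhs_singleton dpsi).
  - exact: (nbhs_singleton du).
  - exact: differentiable_E6.
  - by rewrite -[psi 0]/(psi (0, 0)) psi0; exact: diff_E6.
have hMe (z : C2) i : 
    (M *m \col_i [:: 1; z.1; z.2]`_i) i 0 = M i 0 + M i 1 * z.1 + M i 2 * z.2.
  by rewrite mxE !big_ord_recl big_ord0 !mxE /= mulr1 addr0 addrA;
     congr (_ + M _ _ * _ + M _ _ * _); apply/val_inj.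
pose line (d : 'I_3 -> C) : {poly C} :=
  cubic_sextic ((v 0)%:P + d 0 *: 'X) ((v 1)%:P + d 1 *: 'X)
               ((v 2)%:P + d 2 *: 'X).
have lineE (d : 'I_3 -> C) t : (line d).[t] =
    cubic_sextic (v 0 + d 0 * t) (v 1 + d 1 * t) (v 2 + d 2 * t).
  transitivity (horner_eval t (line d)) => //.
  rewrite rmorph_cubic_sextic; congr cubic_sextic;
  by rewrite /= /horner_eval hornerD hornerC hornerZ hornerX.
have F0 : cubic_sextic (v 0) (v 1) (v 2) = 0.
  have : h 0 = 0 by rewrite (nbhs_singleton hE) -[psi _]/(psi 0) nf0 mulr0.
  rewrite /h /affine_equation eval3_curve_form !hMe /= !mulr0 !addr0 //.
have dir (d : 'I_3 -> C) e : (forall t, h (t *: e) = (line d).[t]) ->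
   d 0 * partial1 (v 0) (v 1) (v 2) + d 1 * partial1 (v 1) (v 2) (v 0)
     + d 2 * partial1 (v 2) (v 0) (v 1) = 0.
  move=> /derive_line; rewrite D0 => ->.
  by have [_ ->] := horner_deriv_line (erefl (line d)).
pose G : 'rV[C]_3 := \row_i
  [:: partial1 (v 0) (v 1) (v 2); partial1 (v 1) (v 2) (v 0);
      partial1 (v 2) (v 0) (v 1)]`_i.
have GM : G *m M = 0.
  apply/rowP => j; rewrite !mxE !big_ord_recl big_ord0 addr0 !mxE addrA.
  rewrite ![_ * M _ _]mulrC.
  have -> : lift ord0 ord0 = 1 :> 'I_3 by apply/val_inj.
  have -> : lift ord0 (lift ord0 ord0) = 2 :> 'I_3 by apply/val_inj.
  case: j => [[|[|[|//]]] hj].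
  - have -> : Ordinal hj = 0 by apply/val_inj.
    by rewrite partial1_euler F0 mulr0.
  - have -> : Ordinal hj = 1 by apply/val_inj.
    apply: (dir (fun i => M i 1) (1, 0)) => t.
    have -> : t *: ((1, 0) : C2) = (t, 0).
      by congr pair; [exact: mulr1 | exact: mulr0].
    by rewrite lineE /h /affine_equation eval3_curve_form !hMe /= !mulr0 !addr0.
  - have -> : Ordinal hj = 2 by apply/val_inj.
    apply: (dir (fun i => M i 2) (0, 1)) => t.
    have -> : t *: ((0, 1) : C2) = (0, t).
      by congr pair; [exact: mulr0 | exact: mulr1].
    by rewrite lineE /h /affine_equation eval3_curve_form !hMe /= !mulr0 !addr0.
have G0 : G = 0 by rewrite -(mulmxK uM G) GM mul0mx.
have g i : G 0 i = 0 by rewrite G0 mxE.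
split => //.
- by have := g 0; rewrite mxE.
- by have := g 1; rewrite mxE.
- by have := g 2; rewrite mxE.
Qed.

End E6Singular.

(** * The germ at [(1 : 1 : 0)] and its normal form *)

Section CuspUnits.
Variable C : numFieldType.
Local Notation C2 := (C^o * C^o)%type.

(* The divided difference [(sextic X Y Z - sextic X Y 0) / Z], where
   [s = X + Y] and [m = X * Y]. *)
Definition sextic_quot (s m Z : C) : C :=
  let a0 := s ^+ 2 - 12 * m in
  let a1 := Z - 10 * s in
  let b1 := 4 * s ^+ 3 + 6 * s ^+ 2 * Z + 4 * s * Z ^+ 2 + Z ^+ 3
            + 216 * m * (s + Z) in
  let c1 := 6 * s ^+ 5 + 15 * s ^+ 4 * Z + 20 * s ^+ 3 * Z ^+ 2
            + 15 * s ^+ 2 * Z ^+ 3 + 6 * s * Z ^+ 4 + Z ^+ 5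
            - 540 * m * (s + Z) ^+ 3 - 5832 * m ^+ 2 * Z in
  16 * c1 + 12 * (a0 * b1 + s ^+ 4 * a1 + Z * a1 * b1)
  - (3 * a0 ^+ 2 * a1 + 3 * a0 * a1 ^+ 2 * Z + a1 ^+ 3 * Z ^+ 2).

Lemma sextic_quotE X Y Z :
  sextic X Y Z = sextic X Y 0 + Z * sextic_quot (X + Y) (X * Y) Z.
Proof. by rewrite /sextic /sextic_quot /inv18 /inv12 /inv6; ring. Qed.

(** Comes from [sextic_Z0], since [(1 + x)^3 - (1 - x)^3 = 2 x (3 + x^2)] and [27 * 2^4 = 432]. *)
Definition coef_x4 (z : C2) : C^o :=
  432 * (3 + z.1 ^+ 2) ^+ 4
  * ((1 + z.1) ^+ 6 + 6 * (1 - z.1 ^+ 2) ^+ 3 + (1 - z.1) ^+ 6).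

Definition coef_y3 (z : C2) : C^o :=
  sextic_quot (2 + 6 * z.1 ^+ 2) ((1 - z.1 ^+ 2) ^+ 3) (z.2 ^+ 3).

(** The chart [(1 + x : 1 - x : y)] is adapted to the two mirrors through its centre: [x = 0] is
    where the first two coordinates agree, and [y = 0] is where the third vanishes. *)
Lemma cubic_sextic_cusp (z : C2) :
  cubic_sextic (1 + z.1) (1 - z.1) z.2 =
  coef_x4 z * z.1 ^+ 4 + coef_y3 z * z.2 ^+ 3.
Proof.
case: z => x y; rewrite /coef_x4 /coef_y3 /cubic_sextic sextic_quotE sextic_Z0 /=.
have -> : 2 + 6 * x ^+ 2 = (1 + x) ^+ 3 + (1 - x) ^+ 3 :> C by ring.
have -> : (1 - x ^+ 2) ^+ 3 = (1 + x) ^+ 3 * (1 - x) ^+ 3 :> C by ring.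
move: (sextic_quot _ _ _) => B; ring.
Qed.

Lemma coef_x4_neq0 : coef_x4 (0, 0) != 0.
Proof.
have -> : coef_x4 (0, 0) = (432 * 81 * 8)%:R by rewrite /coef_x4 /= !natrM; ring.
by rewrite pnatr_eq0.
Qed.

Lemma coef_y3_neq0 : coef_y3 (0, 0) != 0.
Proof.
have -> : coef_y3 (0, 0) = - (512 * 216)%:R.
  by rewrite /coef_y3 /sextic_quot /= !natrM; ring.
by rewrite oppr_eq0 pnatr_eq0.
Qed.

End CuspUnits.

Section Differentiable.
Variable C : numFieldType.
Local Notation C2 := (C^o * C^o)%type.
Implicit Types (f g : C2 -> C) (z : C2).

Definition dif f z := differentiable (f : C2 -> C^o) z.

Lemma difC (c : C) z : dif (fun=> c) z.
Proof. exact: differentiable_cst. Qed.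

Lemma difD f g z : dif f z -> dif g z -> dif (fun w => f w + g w) z.
Proof. exact: differentiableD. Qed.

Lemma difN f z : dif f z -> dif (fun w => - f w) z.
Proof. exact: differentiableN. Qed.

Lemma difM f g z : dif f z -> dif g z -> dif (fun w => f w * g w) z.
Proof. exact: differentiableM. Qed.

Lemma difX f n z : dif f z -> dif (fun w => f w ^+ n) z.
Proof.
move=> df; elim: n => [|n ih]; first exact: difC.
have -> : (fun w => f w ^+ n.+1) = (fun w => f w * f w ^+ n).
  by apply/funext => w; rewrite exprS.
exact: difM.
Qed.

Lemma difV f z : dif f z -> f z != 0 -> dif (fun w => (f w)^-1) z.
Proof. exact: differentiableV. Qed.

Lemma dif_fst z : dif fst z. Proof. exact: differentiable_fst. Qed.
Lemma dif_snd z : dif snd z. Proof. exact: differentiable_snd. Qed.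

Lemma near_neq0 f z : dif f z -> f z != 0 -> \forall w \near z, f w != 0.
Proof.
move=> /differentiable_continuous df; apply: cvgr_neq0 df.
Qed.

(** By the product rule at a zero of each coordinate, the differential is diagonal with entries
    [k1 0] and [k2 0]. *)
Lemma bijective_diff_diag (k1 k2 : C2 -> C) :
  dif k1 0 -> dif k2 0 -> k1 0 != 0 -> k2 0 != 0 ->
  bijective ('d (fun z : C2 => (z.1 * k1 z, z.2 * k2 z) : C2) (0 : C2)).
Proof.
move=> dk1 dk2 k10 k20.
pose psi1 : C2 -> C^o := fst * (k1 : C2 -> C^o).
pose psi2 : C2 -> C^o := snd * (k2 : C2 -> C^o).
have d1 : differentiable psi1 0.
  by apply: differentiableM; [exact: differentiable_fst | exact: dk1].
have d2 : differentiable psi2 0.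
  by apply: differentiableM; [exact: differentiable_snd | exact: dk2].
have dE : 'd (fun z : C2 => (psi1 z, psi2 z)) (0 : C2) =
    (fun e : C2 => (k1 0 * e.1, k2 0 * e.2)) :> (C2 -> C2).
  rewrite (diff_pair d1 d2); apply/funext => e.
  have -> : 'd psi1 0 = k1 0 \*: fst :> (C2 -> C^o).
    by rewrite diffM_zero ?diff_fst //; exact: differentiable_fst.
  have -> : 'd psi2 0 = k2 0 \*: snd :> (C2 -> C^o).
    by rewrite diffM_zero ?diff_snd //; exact: differentiable_snd.
  by [].
rewrite -[X in bijective X]/('d (fun z : C2 => (psi1 z, psi2 z)) (0 : C2) : C2 -> C2) dE.
exists (fun e : C2 => ((k1 0)^-1 * e.1, (k2 0)^-1 * e.2)) => -[x y] /=.
  by rewrite !mulKf.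
by rewrite !mulVKf.
Qed.

End Differentiable.

Ltac dif := repeat first
  [ exact: difC | exact: dif_fst | exact: dif_snd
  | apply: difX | apply: difD | apply: difN | apply: difM ].

Lemma dif_coef_x4 (C : numFieldType) z : dif (@coef_x4 C) z.
Proof. by rewrite /coef_x4; dif. Qed.

Lemma dif_coef_y3 (C : numFieldType) z : dif (@coef_y3 C) z.
Proof. by rewrite /coef_y3 /sextic_quot; dif. Qed.

Section Germ.
Variable R : realType.
Local Notation C := R[i].
Local Notation C2 := (C^o * C^o)%type.

(* With [psi := (x A B^2, - y A B^3)] the terms [y^3] and [x^4] of the normal
   form both become [- A^3 B^8] times those of the given germ, so that no roots
   of [A] and [B] are needed. *)
Lemma germ_equivalent_E6 (A B : C2 -> C) :
  (forall z, dif A z) -> (forall z, dif B z) -> A 0 != 0 -> B 0 != 0 ->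
  germ_equivalent (fun z : C2 => A z * z.1 ^+ 4 + B z * z.2 ^+ 3) (@E6_normal_form R).
Proof.
move=> dA dB A0 B0.
pose k1 z := A z * B z ^+ 2; pose k2 z := - (A z * B z ^+ 3).
pose psi1 : C2 -> C^o := fst * (k1 : C2 -> C^o).
pose psi2 : C2 -> C^o := snd * (k2 : C2 -> C^o).
pose u z := - (A z ^+ 3 * B z ^+ 8)^-1.
have dk1 z : dif k1 z by rewrite /k1; apply: difM => //; apply: difX.
have dk2 z : dif k2 z by rewrite /k2; apply: difN; apply: difM => //; apply: difX.
have k10 : k1 0 != 0 by rewrite mulf_neq0 // expf_neq0.
have k20 : k2 0 != 0 by rewrite oppr_eq0 mulf_neq0 // expf_neq0.
have d1 z : differentiable psi1 z.
  by apply: differentiableM; [exact: differentiable_fst | exact: dk1].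
have d2 z : differentiable psi2 z.
  by apply: differentiableM; [exact: differentiable_snd | exact: dk2].
exists (fun z => (psi1 z, psi2 z)), u; split.
- by congr pair; exact: mul0r.
- by apply: (@filterE _ (nbhs (0 : C2))) => z; exact: differentiable_pair.
- exact: (@bijective_diff_diag C k1 k2).
- split.
    (* The inverse in [u] is differentiable only where [A] and [B] do not vanish, which holds near
       the origin. *)
    have nA := near_neq0 (dA 0) A0; have nB := near_neq0 (dB 0) B0.
    near=> z; apply: difN; apply: difV.
      by apply: difM; exact: difX.
    by rewrite mulf_neq0 // expf_neq0 //; [near: z; exact: nA | near: z; exact: nB].
  by rewrite oppr_eq0 invr_eq0 mulf_neq0 // expf_neq0.
- have nA := near_neq0 (dA 0) A0; have nB := near_neq0 (dB 0) B0.
  near=> z.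
  have Az : A z != 0 by near: z; exact: nA.
  have Bz : B z != 0 by near: z; exact: nB.
  rewrite /E6_normal_form /= /u -[psi1 z]/(z.1 * (A z * B z ^+ 2)).
  rewrite -[psi2 z]/(z.2 * (- (A z * B z ^+ 3))).
  by field; rewrite Az Bz.
Unshelve. all: end_near. Qed.

End Germ.

(** * Invariance under the group *)

Section Fourier.
Variable K : numFieldType.
Implicit Types x y z w : K.

(** In these terms the Fourier matrix acts simply: [S] becomes [3 S + 18 T], [T] becomes [S - 3 T],
    and [a] is multiplied by [-27]. *)
Lemma cubic_sextic_sym x y z : let S := x ^+ 3 + y ^+ 3 + z ^+ 3 in
  let T := x * y * z in
  let a := inv6 (x ^+ 3) (y ^+ 3) (z ^+ 3) in
  cubic_sextic x y z = 16 * (S ^+ 6 - 540 * T ^+ 3 * S ^+ 3 - 5832 * T ^+ 6)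
    + 12 * (a * (S * (S ^+ 3 + 216 * T ^+ 3))) - a ^+ 3.
Proof.
move=> S T a; rewrite /cubic_sextic /sextic /inv18 /inv12 -/a -/S.
by have -> : x ^+ 3 * y ^+ 3 * z ^+ 3 = T ^+ 3; [rewrite /T; ring | ring].
Qed.

(* In the Fourier coordinates, the reflection of [cubic_sextic_reflection]
   multiplies the first coordinate by [w]. *)
Lemma cubic_sextic_fourier x y z w : w ^+ 2 = - w - 1 ->
  cubic_sextic (x + y + z) (x + w * y + w ^+ 2 * z) (x + w ^+ 2 * y + w * z) =
  - 19683 * cubic_sextic x y z.
Proof.
move=> hw; set p := x + y + z; set q := x + _ + _; set r := x + _ + _.
(* [q] and [r] enter only through their sum and product, from which [w] disappears. *)
have qr1 : q + r = 2 * x - y - z.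
  have -> : q + r = 2 * x + (w + w ^+ 2) * (y + z) by rewrite /q /r; ring.
  by rewrite hw; ring.
have qr2 : q * r = x ^+ 2 + y ^+ 2 + z ^+ 2 - x * y - y * z - z * x.
  by rewrite /q /r hw; ring: hw.
have S' : p ^+ 3 + q ^+ 3 + r ^+ 3 = 3 * (x ^+ 3 + y ^+ 3 + z ^+ 3) + 18 * (x * y * z).
  have -> : p ^+ 3 + q ^+ 3 + r ^+ 3 =
    p ^+ 3 + ((q + r) ^+ 3 - 3 * (q * r) * (q + r)) by ring.
  by rewrite qr1 qr2 /p; ring.
have T' : p * q * r = x ^+ 3 + y ^+ 3 + z ^+ 3 - 3 * (x * y * z).
  by rewrite -mulrA qr2 /p; ring.
have a' : inv6 (p ^+ 3) (q ^+ 3) (r ^+ 3) = - 27 * inv6 (x ^+ 3) (y ^+ 3) (z ^+ 3).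
  have -> : inv6 (p ^+ 3) (q ^+ 3) (r ^+ 3) = (p ^+ 3 + q ^+ 3 + r ^+ 3) ^+ 2
      - 12 * (p ^+ 3 * ((q + r) ^+ 3 - 3 * (q * r) * (q + r)) + (q * r) ^+ 3).
    by rewrite /inv6; ring.
  by rewrite S' qr1 qr2 /p /inv6; ring.
rewrite !cubic_sextic_sym S' T' a'; move: (inv6 _ _ _) => a.
move: (x ^+ 3 + y ^+ 3 + z ^+ 3) (x * y * z) => S T; ring.
Qed.

Lemma cubic_sextic_reflection x y z w : w ^+ 2 = - w - 1 ->
  let c := (w - 1) / 3 * (x + y + z) in
  cubic_sextic (x + c) (y + c) (z + c) = cubic_sextic x y z.
Proof.
move=> hw c; have w3 : w ^+ 3 = 1 by rewrite exprS hw; ring: hw.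
(* The Fourier factor [(-27)^3] can be cancelled, so invariance may be checked in Fourier
   coordinates. *)
have nz : - 19683 != 0 :> K by rewrite oppr_eq0 pnatr_eq0.
apply: (mulfI nz); rewrite -!(cubic_sextic_fourier _ _ _ hw).
have -> : x + c + (y + c) + (z + c) = w * (x + y + z) by rewrite /c; field.
have -> : x + c + w * (y + c) + w ^+ 2 * (z + c) = x + w * y + w ^+ 2 * z.
  transitivity (x + w * y + w ^+ 2 * z + (1 + w + w ^+ 2) * c); first by ring.
  by rewrite hw; ring.
have -> : x + c + w ^+ 2 * (y + c) + w * (z + c) = x + w ^+ 2 * y + w * z.
  transitivity (x + w ^+ 2 * y + w * z + (1 + w + w ^+ 2) * c); first by ring.
  by rewrite hw; ring.
by rewrite /cubic_sextic exprMn w3 mul1r.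
Qed.

End Fourier.

Section Invariance.
Variable R : realType.
Local Notation C := R[i].
Local Notation f := (curve_form C).
Local Notation w := (omega R).

Lemma omega2 : w ^+ 2 = - w - 1.
Proof.
have s3 : Num.sqrt (3 : R) ^+ 2 = 3 by rewrite sqr_sqrtr.
rewrite /omega expr2; simpc; congr (_ +i* _).
  have -> : Num.sqrt 3 / 2 * (Num.sqrt 3 / 2) = (Num.sqrt 3 ^+ 2) / 4 :> R by field.
  by rewrite s3; field.
by field.
Qed.

Lemma omega3 : w ^+ 3 = 1.
Proof. by rewrite exprS omega2; ring: omega2. Qed.

Lemma omega_neq1 : w != 1.
Proof.
apply/eqP => w1; have := omega2; rewrite w1 expr1n => /eqP.
rewrite -subr_eq0; have -> : 1 - (- 1 - 1) = 3 :> C by ring.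
by rewrite pnatr_eq0.
Qed.

Definition preserves (g : 'M[C]_3) := forall v, eval3 f (g *m v) = eval3 f v.

(** The product of [1 + a N] and [1 + b N] is [1 + (a + b + k a b) N]; this exhibits inverses of
    reflections. *)
Lemma unit_of_square n (N : 'M[C]_n) k a b :
  N *m N = k *: N -> a + b + k * a * b = 0 -> 1%:M + a *: N \in unitmx.
Proof.
move=> NN ab; suff /mulmx1_unit[] : (1%:M + a *: N) *m (1%:M + b *: N) = 1%:M by [].
rewrite mulmxDl mul1mx mulmxDr mulmx1 -scalemxAl -scalemxAr NN.
transitivity (1%:M + (a + b + k * a * b) *: N).
  by apply/matrixP => i j; rewrite !mxE; ring.
by rewrite ab scale0r addr0.
Qed.

Lemma G26_s_unit : G26_s R \in unitmx. Proof. exact: unitmx_perm. Qed.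

Lemma G26_t_unit : G26_t R \in unitmx.
Proof.
(* The inverse reflection has eigenvalue [w ^+ 2] in place of [w]. *)
apply: (@unit_of_square _ _ 1 _ (w ^+ 2 - 1)).
  by rewrite mul_delta_mx scale1r.
by ring: omega2.
Qed.

Lemma G26_u_unit : G26_u R \in unitmx.
Proof.
apply: (@unit_of_square _ _ 3 _ ((w ^+ 2 - 1) / 3)).
  apply/matrixP => i j; rewrite !mxE.
  by under eq_bigr do rewrite !mxE mulr1; rewrite sumr_const card_ord mulr1.
by field: omega2.
Qed.

Lemma ord3_1 : lift ord0 ord0 = 1 :> 'I_3. Proof. exact/val_inj. Qed.
Lemma ord3_2 : lift ord0 (lift ord0 ord0) = 2 :> 'I_3. Proof. exact/val_inj. Qed.

Lemma sum3 (F : 'I_3 -> C) : \sum_i F i = F 0 + F 1 + F 2.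
Proof. by rewrite !big_ord_recl big_ord0 addr0 addrA ord3_1 ord3_2. Qed.

Lemma cubic_sextic_swap12 (x y z : C) : cubic_sextic x z y = cubic_sextic x y z.
Proof. exact: sextic_swap. Qed.

Lemma cubic_sextic_rot (x y z : C) : cubic_sextic y z x = cubic_sextic x y z.
Proof. exact: sextic_rot. Qed.

Lemma preserves_tperm12 : preserves (tperm_mx 1 2).
Proof.
move=> v; rewrite !eval3_curve_form -xrowE !mxE tpermL tpermR tpermD //.
exact: cubic_sextic_swap12.
Qed.

Lemma preserves_tperm01 : preserves (tperm_mx 0 1).
Proof.
move=> v; rewrite !eval3_curve_form -xrowE !mxE tpermL tpermR tpermD //.
by rewrite -cubic_sextic_rot cubic_sextic_swap12 cubic_sextic_rot.
Qed.

Lemma preserves_diag (d : 'rV[C]_3) :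
  (forall i, d 0 i ^+ 3 = 1) -> preserves (diag_mx d).
Proof.
move=> d3 v; rewrite !eval3_curve_form mul_diag_mx !mxE /cubic_sextic.
by rewrite !exprMn !d3 !mul1r.
Qed.

Lemma preserves_G26_t : preserves (G26_t R).
Proof.
move=> v; rewrite !eval3_curve_form /G26_t mulmxDl mul1mx -scalemxAl.
have dE i : (delta_mx 2 2 *m v) i 0 = (i == 2)%:R * v 2 0.
  by rewrite mxE sum3 !mxE /= !(andbT, andbF) !mul0r !add0r.
have tE i : (v + (w - 1) *: (delta_mx 2 2 *m v)) i 0 =
    v i 0 + (w - 1) * ((i == 2)%:R * v 2 0).
  by rewrite mxE [X in _ + X]mxE dE.
rewrite !tE /= !mul0r !mulr0 !addr0 mul1r.
have -> : v 2 0 + (w - 1) * v 2 0 = w * v 2 0 by ring.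
by rewrite /cubic_sextic exprMn omega3 mul1r.
Qed.

Lemma preserves_G26_u : preserves (G26_u R).
Proof.
move=> v; rewrite !eval3_curve_form /G26_u mulmxDl mul1mx -scalemxAl.
have uE i : (v + (w - 1) / 3 *: (const_mx 1 *m v)) i 0 =
    v i 0 + (w - 1) / 3 * (v 0 0 + v 1 0 + v 2 0).
  by rewrite mxE [X in _ + X]mxE [X in _ * X]mxE sum3 !mxE !mul1r.
by rewrite !uE cubic_sextic_reflection //; exact: omega2.
Qed.

Lemma curve_form_invariant : invariant_under (@G26 R) f.
Proof.
(* [G26] is the smallest matrix group containing the generators, so it lies in the group of all
   invertible matrices preserving the form. *)
move=> g v Gg; suff: [set g | g \in unitmx /\ preserves g] g by case=> _; apply.
apply: Gg; split.
- split => /=.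
  + by move=> h [].
  + by split; [exact: unitmx1 | move=> u; rewrite mul1mx].
  + move=> a b [ua pa] [ub pb]; split; first by rewrite unitmx_mul ua.
    by move=> u; rewrite -mulmxA pa pb.
  + move=> a [ua pa]; split; first by rewrite unitmx_inv.
    by move=> u; rewrite -pa mulKVmx.
- move=> h /= [->|->|->]; split.
  + exact: G26_s_unit.
  + exact: preserves_tperm12.
  + exact: G26_t_unit.
  + exact: preserves_G26_t.
  + exact: G26_u_unit.
  + exact: preserves_G26_u.
Qed.

End Invariance.

(** * The 36 points *)

Section CuspPoints.
Variable R : realType.
Local Notation C := R[i].
Local Notation f := (curve_form C).
Local Notation w := (omega R).

Definition vec3 (x y z : C) : 'cV[C]_3 := \col_i [:: x; y; z]`_i.

Lemma vec3E (v : 'cV[C]_3) : v = vec3 (v 0 0) (v 1 0) (v 2 0).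
Proof.
apply/colP => i; rewrite !mxE.
by case: i => [[|[|[|//]]] hi] /=; congr (v _ _); apply/val_inj.
Qed.

Lemma vec3_scale c x y z : vec3 (c * x) (c * y) (c * z) = c *: vec3 x y z.
Proof. by apply/colP => i; rewrite !mxE; case: i => [[|[|[|//]]] hi]. Qed.

Lemma col_mulmx (g M : 'M[C]_3) j : col j (g *m M) = g *m col j M.
Proof. by rewrite !colE mulmxA. Qed.

Definition E6_at (v : 'cV[C]_3) := E6_point f <[v]>%VS.

(** The charts [M] and [g *m M] give the same affine equation. *)
Lemma E6_at_mul g v : g \in unitmx -> preserves g -> E6_at v -> E6_at (g *m v).
Proof.
move=> ug pg [M [uM /vlineP[c Mv] eqM]]; exists (g *m M); split.
- by rewrite unitmx_mul ug.
- by rewrite col_mulmx Mv -scalemxAr memvZ // memv_line.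
- have -> : affine_equation f (g *m M) = affine_equation f M; last exact: eqM.
  by apply/funext => z; rewrite /affine_equation -mulmxA pg.
Qed.

Lemma E6_at_scale c v : c != 0 -> E6_at v -> E6_at (c *: v).
Proof.
move=> c0 [M [uM Mv eqM]]; exists M; split => //.
by move/vlineP: Mv => [k ->]; apply/vlineP; exists (k / c); rewrite scalerA divfK.
Qed.

Lemma E6_at_rot x y z : E6_at (vec3 x y z) -> E6_at (vec3 y z x).
Proof.
move=> h.
have -> : vec3 y z x = tperm_mx 1 2 *m (tperm_mx 0 1 *m vec3 x y z).
  rewrite -!xrowE; apply/colP => i; rewrite !mxE.
  by case: i => [[|[|[|//]]] hi]; rewrite !permE.
apply: E6_at_mul; [exact: unitmx_perm | exact: preserves_tperm12 |].
by apply: E6_at_mul => //; [exact: unitmx_perm | exact: preserves_tperm01].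
Qed.

Lemma E6_at_diag a b x y z : a ^+ 3 = 1 -> b ^+ 3 = 1 ->
  E6_at (vec3 x y z) -> E6_at (vec3 x (a * y) (b * z)).
Proof.
move=> a3 b3 h; pose d : 'rV[C]_3 := \row_i [:: 1; a; b]`_i.
have d3 i : d 0 i ^+ 3 = 1.
  by rewrite mxE; case: i => [[|[|[|//]]] hi] //=; rewrite expr1n.
have -> : vec3 x (a * y) (b * z) = diag_mx d *m vec3 x y z.
  rewrite mul_diag_mx; apply/colP => i; rewrite !mxE.
  by case: i => [[|[|[|//]]] hi] //=; rewrite mul1r.
apply: E6_at_mul => //; last exact: preserves_diag.
rewrite unitmxE det_diag unitfE; apply/prodf_neq0 => i _.
by apply/eqP => di; have := d3 i; rewrite di expr0n => /eqP; rewrite eq_sym oner_eq0.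
Qed.

Lemma E6_at_110 : E6_at (vec3 1 1 0).
Proof.
pose M : 'M[C]_3 :=
  \matrix_(i, j) (nth [::] [:: [:: 1; 1; 0]; [:: 1; - 1; 0]; [:: 0; 0; 1]] i)`_j.
pose N : 'M[C]_3 := \matrix_(i, j)
  (nth [::] [:: [:: 1 / 2; 1 / 2; 0]; [:: 1 / 2; - (1 / 2); 0]; [:: 0; 0; 1]] i)`_j.
exists M; split.
- suff /mulmx1_unit[] : M *m N = 1%:M by [].
  apply/matrixP => i j; rewrite mxE sum3 !mxE.
  by case: i => [[|[|[|//]]] hi]; case: j => [[|[|[|//]]] hj] /=; field.
- have -> : col 0 M = vec3 1 1 0; last exact: memv_line.
  by apply/colP => i; rewrite !mxE; case: i => [[|[|[|//]]] hi].
- have -> : affine_equation f M =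
      (fun z => coef_x4 z * z.1 ^+ 4 + coef_y3 z * z.2 ^+ 3).
    apply/funext => z; rewrite -cubic_sextic_cusp /affine_equation eval3_curve_form.
    by rewrite !mxE !sum3 !mxE /=; congr cubic_sextic; ring.
  apply: germ_equivalent_E6; [exact: dif_coef_x4 | exact: dif_coef_y3 |
    exact: coef_x4_neq0 | exact: coef_y3_neq0].
Qed.

(** [G26_u] sends [(1, 1, 0)] to a third of [(1 + 2 w, 1 + 2 w, 2 (w - 1))], and
    [2 (w - 1) = - 2 w^2 (1 + 2 w)]. *)
Lemma E6_at_11w : E6_at (vec3 1 1 (- 2 * w ^+ 2)).
Proof.
have w1 : 1 + 2 * w != 0.
  apply/eqP => h; have : (1 + 2 * w) ^+ 2 = - 3.
    have -> : (1 + 2 * w) ^+ 2 = 1 + 4 * w + 4 * w ^+ 2 by ring.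
    by rewrite omega2; ring.
  by rewrite h expr0n /= => /eqP; rewrite eq_sym oppr_eq0 pnatr_eq0.
have -> : vec3 1 1 (- 2 * w ^+ 2) = (3 / (1 + 2 * w)) *: (G26_u R *m vec3 1 1 0).
  have uE i : (G26_u R *m vec3 1 1 0) i 0 = (vec3 1 1 0) i 0 + (w - 1) / 3 * 2.
    rewrite /G26_u mulmxDl mul1mx -scalemxAl mxE [X in _ + X]mxE [X in _ * X]mxE.
    by rewrite sum3 !mxE /=; congr (_ + _ * _); ring.
  apply/colP => i; rewrite [RHS]mxE uE !mxE.
  have hw := omega2 R.
  case: i => [[|[|[|//]]] hi] /=; try by field.
  have -> : - 2 * w ^+ 2 = (- 2 * w ^+ 2 * (1 + 2 * w)) / (1 + 2 * w) by field.
  have -> : - 2 * w ^+ 2 * (1 + 2 * w) = 2 * (w - 1) by ring: hw.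
  by field.
apply: E6_at_scale; first by rewrite mulf_neq0 ?invr_eq0 ?pnatr_eq0.
by apply: E6_at_mul E6_at_110; [exact: G26_u_unit | exact: preserves_G26_u].
Qed.

(** The four numbers whose cube is 0 or -8, the two alternatives in [cusp_cubes]. *)
Definition cusp_height (k : 'I_4) : C := if val k is k'.+1 then - 2 * w ^+ k' else 0.

(* The vector [(1, w^j, h)] with coordinates shifted cyclically by [i]. *)
Definition cusp_vec (i j : 'I_3) (k : 'I_4) : 'cV[C]_3 :=
  \col_l [:: 1; w ^+ j; cusp_height k]`_((l - i)%R : 'I_3).

Lemma cusp_vec0 j k : cusp_vec 0 j k = vec3 1 (w ^+ j) (cusp_height k).
Proof. by apply/colP => l; rewrite !mxE subr0. Qed.

Lemma cusp_vec1 j k : cusp_vec 1 j k = vec3 (cusp_height k) 1 (w ^+ j).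
Proof. by apply/colP => l; rewrite !mxE; case: l => [[|[|[|//]]] hl]. Qed.

Lemma cusp_vec2 j k : cusp_vec 2 j k = vec3 (w ^+ j) (cusp_height k) 1.
Proof. by apply/colP => l; rewrite !mxE; case: l => [[|[|[|//]]] hl]. Qed.

Lemma E6_at_cusp_vec i j k : E6_at (cusp_vec i j k).
Proof.
have w3 n : (w ^+ n) ^+ 3 = 1 by rewrite exprAC omega3 expr1n.
have h0 : E6_at (vec3 1 (w ^+ j) (cusp_height k)).
  case: k => [[|k] hk]; rewrite /cusp_height /=.
    have := @E6_at_diag (w ^+ j) 1 _ _ _ (w3 j) (expr1n _ _) E6_at_110.
    by rewrite mulr1 mulr0.
  have := @E6_at_diag (w ^+ j) (w ^+ k.+1) _ _ _ (w3 j) (w3 _) E6_at_11w.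
  (* The exponent [k.+1] absorbs the [w ^+ 2] of [E6_at_11w], because [w ^+ 3 = 1]. *)
  rewrite mulr1; have -> // : w ^+ k.+1 * (- 2 * w ^+ 2) = - 2 * w ^+ k.
  have -> : w ^+ k.+1 * (- 2 * w ^+ 2) = - 2 * w ^+ k * w ^+ 3 by rewrite exprS; ring.
  by rewrite omega3 mulr1.
have : i \in [:: 0; 1; 2] by case: i => [[|[|[|]]]].
rewrite !inE => /or3P[]/eqP->; rewrite ?cusp_vec0 ?cusp_vec1 ?cusp_vec2 //.
  exact/E6_at_rot/E6_at_rot.
exact/E6_at_rot.
Qed.

Lemma cube_eq (a b : C) : a ^+ 3 = b ^+ 3 -> exists j : 'I_3, a = w ^+ j * b.
Proof.
move=> ab; have hw := omega2 R.
have : (a - b) * ((a - w * b) * (a - w ^+ 2 * b)) = 0.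
  have -> : (a - b) * ((a - w * b) * (a - w ^+ 2 * b)) = a ^+ 3 - b ^+ 3 by ring: hw.
  by rewrite ab subrr.
move/eqP; rewrite !mulf_eq0 !subr_eq0 => /or3P[]/eqP->.
- by exists 0; rewrite mul1r.
- by exists 1.
- by exists 2.
Qed.

Lemma cusp_cubesP (x y z : C) : cusp_cubes (x ^+ 3) (y ^+ 3) (z ^+ 3) ->
  exists (j : 'I_3) k, [/\ x != 0, y = x * w ^+ j & z = x * cusp_height k].
Proof.
case/and3P=> /eqP xy; rewrite expf_eq0 /= => x0 hz.
have [j yE] := cube_eq (esym xy).
exists j; case/orP: hz => [|/eqP hz].
  by rewrite expf_eq0 /= => /eqP ->; exists 0; split; rewrite ?mulr0 // mulrC.
have [k zE] : exists k : 'I_3, z = w ^+ k * (- 2 * x).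
  by apply: cube_eq; rewrite hz; ring.
exists (lift 0 k); split; rewrite // ?(mulrC x) //.
by rewrite zE /cusp_height /=; ring.
Qed.

(** Such a point is singular, so the cubes of its coordinates are known; cube roots of unity and a
    scalar account for the rest. *)
Lemma E6_point_line p : P2 p -> E6_point f p -> exists i j k, p = <[cusp_vec i j k]>%VS.
Proof.
move=> p1 [M [uM Mp eqM]].
have M0 : col 0 M != 0.
  apply/eqP => M0; have : invmx M *m col 0 M = 0 by rewrite M0 mulmx0.
  rewrite -col_mulmx mulVmx // => /colP/(_ 0); rewrite !mxE /= => /eqP.
  by rewrite oner_eq0.
have := E6_singular uM eqM; set v := col 0 M in Mp M0 *.
have -> : p = <[v]>%VS.
  by apply/esym/eqP; rewrite eqEdim -memvE Mp p1 dim_vline M0.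
have vE : v = vec3 (M 0 0) (M 1 0) (M 2 0) by rewrite [LHS]vec3E !mxE.
move: vE; move: (M 0 0) (M 1 0) (M 2 0) => x y z vE.
have line (c : C) i j k : c != 0 -> v = c *: cusp_vec i j k ->
    exists i j k, <[v]>%VS = <[cusp_vec i j k]>%VS.
  move=> c0 ->; exists i, j, k; apply/eqP; rewrite eqEsubv -!memvE.
  rewrite memvZ ?memv_line //=; apply/vlineP; exists c^-1.
  by rewrite scalerA mulVf // scale1r.
have nz : [|| x != 0, y != 0 | z != 0].
  apply: contraNT M0; rewrite !negb_or !negbK => /and3P[/eqP x0 /eqP y0 /eqP z0].
  rewrite vE x0 y0 z0; apply/eqP/colP => i.
  by rewrite !mxE; case: i => [[|[|[|//]]] hi].
move/(singular_cubes nz).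
case/or3P => /cusp_cubesP[j [k [c0 e1 e2]]].
- by apply: (line x 0 j k) => //; rewrite cusp_vec0 -vec3_scale mulr1 -e1 -e2.
- by apply: (line y 1 j k) => //; rewrite cusp_vec1 -vec3_scale mulr1 -e1 -e2.
- by apply: (line z 2 j k) => //; rewrite cusp_vec2 -vec3_scale mulr1 -e1 -e2.
Qed.

(** Tells the height apart from the other two entries of [cusp_vec], whose cubes are 1. *)
Lemma cusp_height_cube k : cusp_height k ^+ 3 != 1.
Proof.
case: k => [[|k] hk]; rewrite /cusp_height /=; first by rewrite expr0n eq_sym oner_eq0.
rewrite exprMn exprAC omega3 expr1n mulr1 -subr_eq0.
have -> : (- 2) ^+ 3 - 1 = - 9 :> C by ring.
by rewrite oppr_eq0 pnatr_eq0.
Qed.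

Lemma omega_inj : {in gtn 3 &, injective (fun n => w ^+ n)}.
Proof.
have w1 := omega_neq1 R; have w3 := omega3 R; have w0 : w != 0.
  by apply/eqP => w0; move/eqP: w3; rewrite w0 expr0n eq_sym oner_eq0.
have w2 : w ^+ 2 != 1.
  by apply: contraNN w1 => /eqP w2; rewrite -w3 exprS w2 mulr1.
have w12 : w != w ^+ 2.
  by apply: contraNN w1 => /eqP e; rewrite -(inj_eq (mulfI w0)) mulr1 -expr2 -e.
move=> [|[|[|//]]] [|[|[|//]]] _ _ //= /eqP.
all: rewrite ?expr0 ?expr1 ?(eq_sym 1) ?(eq_sym _ w).
all: by rewrite ?(negPf w1) ?(negPf w2) ?(negPf w12).
Qed.

Lemma cusp_height_inj : injective cusp_height.
Proof.
move=> k l; have h0 n : - 2 * w ^+ n != 0.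
  rewrite mulf_neq0 ?oppr_eq0 ?pnatr_eq0 // expf_neq0 //.
  apply/eqP => w0; have := omega3 R; rewrite w0 expr0n => /eqP.
  by rewrite eq_sym oner_eq0.
case: k l => [[|k] hk] [[|l] hl]; rewrite /cusp_height /= => e; apply/val_inj => //=.
- by move/eqP: e; rewrite eq_sym (negPf (h0 _)).
- by move/eqP: e; rewrite (negPf (h0 _)).
- congr _.+1; apply: omega_inj => //; apply: (mulfI _ e).
  by rewrite oppr_eq0 pnatr_eq0.
Qed.

Definition cusp_line (a : 'I_3 * 'I_3 * 'I_4) : {vspace 'cV[C]_3} :=
  <[cusp_vec a.1.1 a.1.2 a.2]>%VS.

Lemma cusp_line_inj : injective cusp_line.
Proof.
move=> [[i j] k] [[i' j'] k'] /= e.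
have /vlineP[c ce] : cusp_vec i j k \in <[cusp_vec i' j' k']>%VS.
  by rewrite -[<[_]>%VS]e memv_line.
have ent l : [:: 1; w ^+ j; cusp_height k]`_((l - i)%R : 'I_3) =
             c * [:: 1; w ^+ j'; cusp_height k']`_((l - i')%R : 'I_3).
  by move/colP: ce => /(_ l); rewrite !mxE.
have w3 n : (w ^+ n) ^+ 3 = 1 by rewrite exprAC omega3 expr1n.
have ent1 (m : 'I_3) n h : m != 2 -> [:: 1; w ^+ n; h]`_m ^+ 3 = 1.
  by case: m => [[|[|[|]]]] //= _ _; rewrite ?expr1n ?w3.
have ii' : i = i'.
  have [//|ne] := eqVneq i i'.
  have [l li li'] : exists2 l, l - i != 2 & l - i' != 2.
    (* The heights sit at the positions [i + 2] and [i' + 2]; this is the third position modulo 3,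
       where comparing entries gives [c ^+ 3 = 1]. *)
    exists (2 - (i + i'));
      by case: i i' ne {ce ent e} => [[|[|[|//]]] ?] [[|[|[|//]]] ?].
  have c3 : c ^+ 3 = 1.
    by have := congr1 (fun t => t ^+ 3) (ent l); rewrite exprMn !ent1 // mulr1 => <-.
  have hi : i + 2 - i' != 2.
    by case: i i' ne {ce ent e li li'} => [[|[|[|//]]] ?] [[|[|[|//]]] ?].
  (* Here a height would equal [c] times an entry of cube 1. *)
  have := congr1 (fun t => t ^+ 3) (ent (i + 2)).
  rewrite exprMn c3 mul1r (ent1 (i + 2 - i')) // addrAC subrr add0r => /eqP.
  by rewrite (negPf (cusp_height_cube k)).
rewrite -ii' in ent *.
have c1 : c = 1 by have := ent i; rewrite subrr mulr1.
have jj' : j = j'.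
  have := ent (1 + i); rewrite addrK c1 mul1r => /omega_inj/val_inj; apply;
  by rewrite inE ltn_ord.
have kk' : k = k'.
  by have := ent (2 + i); rewrite addrK c1 mul1r => /cusp_height_inj.
by rewrite jj' kk'.
Qed.

Lemma E6_points_card : ([set p | @P2 R p /\ E6_point f p] #= `I_36)%card.
Proof.
have -> : [set p | @P2 R p /\ E6_point f p] = range cusp_line.
  apply/seteqP; split=> p /=.
    by case=> p1 /(E6_point_line p1)[i [j [k ->]]]; exists (i, j, k).
  case=> -[[i j] k] _ <-; split; last exact: E6_at_cusp_vec.
  rewrite /P2 /= dim_vline.
  have [v0|//] := eqVneq (cusp_vec i j k) 0.
  by move/colP: v0 => /(_ i); rewrite !mxE subrr => /eqP; rewrite oner_eq0.
have inj : {in [set: 'I_3 * 'I_3 * 'I_4] &, injective cusp_line}.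
  by move=> a b _ _; exact: cusp_line_inj.
apply: (card_eq_trans (inj_card_eq inj)).
have c36 : #|{: 'I_3 * 'I_3 * 'I_4}| = 36%N by rewrite !card_prod !card_ord.
pose rank (a : 'I_3 * 'I_3 * 'I_4) : nat := enum_rank a.
have rank_inj : {in [set: 'I_3 * 'I_3 * 'I_4] &, injective rank}.
  by move=> a b _ _ /val_inj; exact: enum_rank_inj.
have -> : `I_36 = range rank.
  rewrite -c36; apply/seteqP; split=> n /=.
    by move=> hn; exists (enum_val (Ordinal hn)); rewrite /rank ?enum_valK.
  by case=> a _ <-; exact: ltn_ord.
exact: card_esym (inj_card_eq rank_inj).
Qed.

End CuspPoints.

Theorem mainTheorem2 (R : realType) :
  exists f : mpoly 3 R[i],
    [/\ plane_curve_equation 18 f,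
        invariant_under (@G26 R) f
      & ([set p | @P2 R p /\ E6_point f p] #= `I_36)%card].
Proof.
exists (curve_form R[i]); split.
- split; last exact: curve_form_squarefree.
    (* The value at [(1, 0, 0)] is 27. *)
    apply/eqP => /(congr1 (meval (fun i => (i == 0)%:R))).
    rewrite meval_curve_form meval0 /cubic_sextic expr1n expr0n /= sextic_Z0 => /eqP.
    have -> : 27 * (1 - 0) ^+ 4 * (1 ^+ 2 + 6 * 1 * 0 + 0 ^+ 2) = 27 :> R[i] by ring.
    by rewrite pnatr_eq0.
  exact: curve_form_homog.
- exact: curve_form_invariant.
- exact: E6_points_card.
Qed.
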